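(* For every cubic bridgeless graph $G$, $m_2(G)\ge \tfrac12\, m_3(G)+\tfrac16$.
   Context: A cubic bridgeless graph is a graph in which every vertex has degree 3 and each connected component is 2-edge-connected. A perfect matching of $G$ is a set of edges such that every vertex is incident to exactly one of them. For a cubic bridgeless graph $G$ and a positive integer $t$, $m_t(G)$ denotes the maximum, over all choices of $t$ perfect matchings $M_1,\dots,M_t$ of $G$, of $|M_1\cup\dots\cup M_t|/|E(G)|$. *)

(* Defs.v *)
From HB Require Import structures.
From mathcomp Require Import all_boot all_order all_algebra.
Set Implicit Arguments.
Unset Strict Implicit.
Unset Printing Implicit Defensive.
Import Order.TTheory GRing.Theory Num.Theory.

(* Finite graphs with parallel edges allowed; simple graphs are the case where
   [ends] is injective. Excluding loops costs nothing for bridgeless cubic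
   graphs: at a vertex of degree 3 carrying a loop, the third edge end belongs
   to a bridge. *)
Record graph := Graph {
  vertex : finType;
  edge : finType;
  ends : edge -> {set vertex};
  ends_card : forall e : edge, #|ends e| = 2
}.

Section GraphDefs.
Variable G : graph.

Definition degree (v : vertex G) : nat := #|[set e : edge G | v \in ends e]|.

Definition cubic : Prop := forall v : vertex G, degree v = 3.

(* Adjacency in G[C] - F, the subgraph induced on C with the edges of F
   deleted. *)
Definition adj_in (C : {set vertex G}) (F : {set edge G}) : rel (vertex G) :=
  fun x y => [&& x \in C, y \in C
               & [exists e : edge G, (e \notin F) && (ends e == [set x; y])]].

Definition component (v : vertex G) : {set vertex G} :=
  [set w | connect (adj_in setT set0) v w].

Definition edge_connected (k : nat) (C : {set vertex G}) : Prop :=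
  forall F : {set edge G}, #|F| < k ->
  forall x y : vertex G, x \in C -> y \in C -> connect (adj_in C F) x y.

Definition bridgeless : Prop :=
  forall v : vertex G, edge_connected 2 (component v).

Definition perfect_matching (M : {set edge G}) : bool :=
  [forall v : vertex G, #|[set e in M | v \in ends e]| == 1].

(* The maximum over an empty family is 0; cubic bridgeless graphs always have a
   perfect matching (Petersen), so for them this default is never used. *)
Definition max_union (t : nat) : nat :=
  \max_(M : {ffun 'I_t -> {set edge G}} | [forall i, perfect_matching (M i)])
     #|\bigcup_(i < t) M i|.

Definition m (t : nat) : rat := ((max_union t)%:R / #|edge G|%:R)%R.

End GraphDefs.

Arguments cubic : clear implicits.
Arguments bridgeless : clear implicits.
Arguments m : clear implicits.

(* Main.v *)
Require Import Defs.
From HB Require Import structures.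
From mathcomp Require Import all_boot all_order all_algebra lra.
Import Order.TTheory GRing.Theory Num.Theory.
Set Implicit Arguments.
Unset Strict Implicit.
Unset Printing Implicit Defensive.

(* If A, B, C are perfect matchings with |A u B u C| maximal, then A u B and
   A u C have union A u B u C and both contain A, so the larger of the two has
   at least (|A u B u C| + |A|) / 2 edges, and |A| = |E| / 3. Since the maximum
   over an empty family is 0, this also requires Petersen's theorem. It follows
   from Tutte's: an odd set with no edge to the outside except into a barrier U
   sends at least 3 edges into U by parity and bridgelessness, whereas U
   absorbs at most 3 |U|. Tutte's theorem is proved by Lovasz's argument: in an
   edge-maximal graph without perfect matching, the vertices that are not
   adjacent to all others span a disjoint union of cliques. *)

(** * Tutte's theorem *)

Section Tutte.
Variable V : finType.
Implicit Types (e : rel V) (f g : V -> V) (x y : V).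

(** A perfect matching of [e], encoded by the map sending each vertex to its mate. *)
Definition has_pairing e : bool :=
  [exists f : {ffun V -> V},
     [forall x, [&& f (f x) == x, f x != x & e x (f x)]]].

Lemma has_pairingP e :
  reflect (exists f, [/\ involutive f, forall x, f x != x & forall x, e x (f x)])
          (has_pairing e).
Proof.
apply: (iffP existsP) => [[f /forallP fP]|[f [fK f_neq ef]]].
  by exists f; split=> x; have /and3P[/eqP] := fP x.
by exists (finfun f); apply/forallP=> x; rewrite !ffunE fK f_neq ef eqxx.
Qed.

(** Equality would make a palindrome in [f] and [g] fix a point. Cancelling one letter at each end
    conjugates it to a shorter one, down to a single [f] or [g]. *)
Lemma iter_comp_involution_neq f g i x :
    involutive f -> involutive g ->
    (forall y, f y != y) -> (forall y, g y != y) ->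
  iter i (g \o f) x != g x.
Proof.
move=> fK gK f_neq g_neq.
have [m] := ubnP i; elim: m i x => // m IHm [|[|i]] x lt_im.
- by rewrite /= eq_sym g_neq.
- by rewrite /= (can_eq gK) f_neq.
rewrite iterSr iterS /= (can_eq gK); apply/eqP => fsx.
have /negP[] := IHm i (g (f x)) (ltnW lt_im).
by rewrite gK -(inv_eq fK) fsx.
Qed.

(* In the union of the two pairings the pair {b, d} lies on an alternating
   cycle. If that cycle misses {a, c}, switch between f and g along it;
   otherwise follow it from d, starting with f, up to the first of a and c,
   and close up with the chord joining that vertex to b. *)
Lemma exchange_pairing e f g a b c d :
    symmetric e -> involutive f -> involutive g ->
    (forall x, f x != x) -> (forall x, g x != x) ->
    f a = c -> g b = d -> e a b -> e b c -> a != b -> c != b ->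
    (forall x, x != a -> x != c -> e x (f x)) ->
    (forall x, x != b -> x != d -> e x (g x)) ->
  has_pairing e.
Proof.
move=> e_sym fK gK f_neq g_neq fa gb eab ebc neq_ab neq_cb ef eg.
have fc : f c = a by rewrite -fa fK.
have gd : g d = b by rewrite -gb gK.
pose s := g \o f.
have s_inj : injective s by apply: inj_comp; apply: inv_inj.
apply/has_pairingP.
have [/existsP[x /andP[/iter_findex <-]] | ] := boolP [exists x, fconnect s d x && (x \in pred2 a c)].
  move: (findex _ _ _) => k0 k0P.
  case: (ex_minnP (ex_intro (fun k => iter k s d \in pred2 a c) k0 k0P)).
  move=> k; set t := iter k s d => t_ac k_min {x k0 k0P}.
  have before i : i < k -> iter i s d \notin pred2 a c.
    by apply: contraL => /k_min; rewrite -leqNgt.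
  (* [Q] is the stretch of the cycle strictly between [b] and [t]. The new pairing is [f] on [Q],
     the chord from [b] to [t], and [g] elsewhere. *)
  pose Q := [set x | [exists i : 'I_k, (x == iter i s d) || (x == f (iter i s d))]].
  have QP x : reflect (exists2 i, i < k & x = iter i s d \/ x = f (iter i s d)) (x \in Q).
    rewrite inE; apply: (iffP existsP) => [[i /orP xP]|[i lt_ik xP]].
      by exists i => //; case: xP => /eqP; [left|right].
    by exists (Ordinal lt_ik); apply/orP; case: xP => ->; [left|right]; apply/eqP.
  clearbody Q.
  have fQ x : x \in Q -> f x \in Q.
    by case/QP=> i lt_ik [] ->; apply/QP; exists i; rewrite ?fK //; [right|left].
  have tQ : t \notin Q.
    apply/QP => -[i lt_ik [] tE]; have /negP[] := before i lt_ik.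
      by rewrite -tE.
    rewrite -(fK (iter i s d)) -tE.
    by case/pred2P: t_ac => ->; rewrite !inE ?fa ?fc eqxx ?orbT.
  have bQ : b \notin Q.
    apply/QP => -[i lt_ik [] bE].
      by have := iter_comp_involution_neq i d fK gK f_neq g_neq; rewrite gd -bE eqxx.
    (* If [f] sent step [i] to [b], step [i.+1] would be back at [d], and skipping this full turn
       would reach [t] before step [k]. *)
    have sd : iter i.+1 s d = d by rewrite -[LHS]/(g (f (iter i s d))) -bE gb.
    have lt_k : k - i.+1 < k by rewrite ltn_subrL (leq_trans _ lt_ik).
    by have /negP[] := before _ lt_k; rewrite -{1}sd -iterD subnK.
  have neq_tb : t != b by case/pred2P: t_ac => ->.
  have sQ i : i <= k -> iter i s d \in [predU pred2 t b & Q].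
    rewrite leq_eqVlt => /predU1P[-> | lt_ik]; first by rewrite !inE eqxx.
    by rewrite inE (_ : _ \in Q) ?orbT //; apply/QP; exists i; rewrite //; left.
  have fsQ i : i < k -> f (iter i s d) \in [predU pred2 t b & Q].
    by move=> lt_ik; rewrite inE (_ : _ \in Q) ?orbT //; apply/QP; exists i; rewrite //; right.
  have gsQ i : i <= k -> g (iter i s d) \in [predU pred2 t b & Q].
    case: i => [_ | i lt_ik]; first by rewrite gd !inE eqxx orbT.
    by rewrite -[iter _ _ _]/(g (f (iter i s d))) gK fsQ.
  have gQ x : x \in [predU pred2 t b & Q] -> g x \in [predU pred2 t b & Q].
    case/orP=> [/pred2P[] -> | /QP[i lt_ik [] ->]]; first exact: gsQ.
    - by rewrite gb (sQ 0).
    - exact/gsQ/ltnW.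
    by rewrite -[g _]/(iter i.+1 s d) sQ.
  have gQ' x : (g x \in [predU pred2 t b & Q]) = (x \in [predU pred2 t b & Q]).
    by apply/idP/idP=> /gQ //; rewrite gK.
  have ebt : e b t by case/pred2P: t_ac => -> //; rewrite e_sym.
  pose h x := if x == t then b else if x == b then t else if x \in Q then f x else g x.
  have hP x : [/\ h (h x) = x, h x != x & e x (h x)].
    rewrite /h; have [-> | neq_xt] := eqVneq x t.
      by rewrite eqxx eq_sym (negPf neq_tb) e_sym; split.
    have [-> | neq_xb] := eqVneq x b; first by rewrite eqxx; split.
    have [xQ | xQ] := boolP (x \in Q).
      have neq_ft : f x != t by apply: contraNneq tQ => <-; apply: fQ.
      have neq_fb : f x != b by apply: contraNneq bQ => <-; apply: fQ.
      rewrite (negPf neq_ft) (negPf neq_fb) fQ //; split=> //.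
      apply: ef.
        apply: contraNneq neq_xt => xa; case/pred2P: t_ac neq_ft => -> //.
          by rewrite xa.
        by rewrite xa fa eqxx.
      apply: contraNneq neq_xt => xc; case/pred2P: t_ac neq_ft => ->.
        by rewrite xc fc eqxx.
      by rewrite xc.
    have := gQ' x; rewrite !inE (negPf neq_xt) (negPf neq_xb) (negPf xQ) /=.
    move/negbT; rewrite !negb_or => /andP[/andP[/negPf-> /negPf->] /negPf->].
    rewrite gK; split=> //; apply: eg => //.
    apply/eqP=> xd; have := sQ 0 isT.
    by rewrite !inE /= -xd (negPf neq_xt) (negPf neq_xb) (negPf xQ).
  by exists h; split=> x; have [] := hP x.
rewrite negb_exists => /forallP no_ac.
(* The orbit of [s] takes only every other vertex of the cycle; adding its image under [f] gives the
   whole cycle, closed under [f] and [g]. *)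
pose C x := fconnect s d x || fconnect s d (f x).
have gfE x : fconnect s d (g x) = fconnect s d (f x).
  by rewrite -[in LHS](fK x) -[g _]/(s (f x)) -same_fconnect1_r.
have fC x : C (f x) = C x by rewrite /C fK orbC.
have gC x : C (g x) = C x.
  by rewrite /C gfE orbC; congr (_ || _); rewrite (same_fconnect1_r s_inj) /s /= fK gK.
have Ca : ~~ C a.
  by have := no_ac a; have := no_ac c; rewrite /C fa !inE !eqxx orbT !andbT => /negPf-> /negPf->.
have Cc : ~~ C c by rewrite -fa fC.
have Cd : C d by rewrite /C connect0.
have Cb : C b by rewrite -gd gC.
exists (fun x => if C x then f x else g x); split=> x.
- by case Cx: (C x); rewrite ?fC ?gC Cx ?fK ?gK.
- by case: (C x).
case: ifPn => Cx.
  by apply: ef; apply: contraTneq Cx => ->.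
by apply: eg; apply: contraNneq Cx => ->.
Qed.

(** * Partial pairings with the fewest unpaired vertices *)

Lemma involution_even f (A : {set V}) :
    involutive f -> {in A, forall x, f x \in A} -> {in A, forall x, f x != x} ->
  ~~ odd #|A|.
Proof.
move=> fK; have [m] := ubnP #|A|; elim: m A => // m IHm A lt_Am fA f_neq.
have [-> | [x xA]] := set_0Vmem A; first by rewrite cards0.
have fxA : f x \in A :\ x by rewrite !inE f_neq ?fA.
rewrite (cardsD1 x A) xA (cardsD1 (f x) (A :\ x)) fxA /= negbK.
apply: IHm => [|y|y].
- rewrite (cardsD1 x A) xA (cardsD1 (f x) (A :\ x)) fxA in lt_Am.
  exact: ltnW.
- rewrite !inE => /and3P[neq_yfx neq_yx /fA ->].
  by rewrite (inj_eq (inv_inj fK)) neq_yx (inv_eq fK) neq_yfx.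
by rewrite !inE => /and3P[_ _ /f_neq].
Qed.

(* With [e] reflexive, unmatched vertices are the fixed points of [f]. *)
Definition partial_pairing e f := involutive f /\ forall x, e x (f x).

Definition unpaired f := [set x | f x == x].

Definition max_pairing e f :=
  partial_pairing e f /\
  forall g, partial_pairing e g -> #|unpaired f| <= #|unpaired g|.

Lemma max_pairing_exists e : reflexive e -> exists f, max_pairing e f.
Proof.
move=> e_refl.
pose P (f : {ffun V -> V}) := [forall x, (f (f x) == x) && e x (f x)].
have Pid : P (finfun id) by apply/forallP=> x; rewrite !ffunE eqxx e_refl.
case: (arg_minnP (fun f : {ffun V -> V} => #|unpaired f|) Pid) => f /forallP fP f_min.
exists f; split=> [|g [gK eg]].
  by split=> x; have /andP[/eqP] := fP x.
have /f_min : P (finfun g) by apply/forallP=> x; rewrite !ffunE gK eqxx eg.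
suff -> : unpaired (finfun g) = unpaired g by [].
by apply/setP=> x; rewrite !inE ffunE.
Qed.

(* For a fixed point p of f: matching p with q turns the former mate of q into
   a fixed point, so the defect moves from p to f q. *)
Definition rematch f p q x :=
  if x == p then q else if x == q then p else if x == f q then x else f x.

Lemma rematch_pairing e f p q :
    symmetric e -> reflexive e -> partial_pairing e f -> f p = p -> p != q -> e p q ->
  partial_pairing e (rematch f p q).
Proof.
move=> e_sym e_refl [fK ef] fp neq_pq epq; split=> x; rewrite /rematch.
  have [-> | neq_xp] := eqVneq x p; first by rewrite eq_sym (negPf neq_pq) eqxx.
  have [-> | neq_xq] := eqVneq x q; first by rewrite eqxx.
  have [xE | neq_xfq] := eqVneq x (f q).
    by rewrite (negPf neq_xp) (negPf neq_xq) xE eqxx.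
  by rewrite !(inv_eq fK) fp (negPf neq_xp) (negPf neq_xfq) fK (negPf neq_xq).
have [-> // | neq_xp] := eqVneq x p.
have [-> | neq_xq] := eqVneq x q; first by rewrite e_sym.
by case: eqP.
Qed.

(** Removing [q] last covers the case that [q] is a fixed point too: then [f q] is [q], and both [p]
    and [q] become paired. *)
Lemma unpaired_rematch f p q :
    involutive f -> f p = p -> p != q ->
  unpaired (rematch f p q) = (f q |: (unpaired f :\ p)) :\ q.
Proof.
move=> fK fp neq_pq; apply/setP=> x; rewrite !inE /rematch.
have [-> | neq_xp] := eqVneq x p.
  rewrite eq_sym (negPf neq_pq) /=; apply/esym/negbTE.
  by rewrite orbF -fp (inv_eq fK) fK.
have [-> | neq_xq] := eqVneq x q; first by rewrite (negPf neq_pq).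
by case: (x =P f q) => [-> | _] /=; rewrite ?eqxx.
Qed.

(** Pairing distinct [x] and [y] would leave two fewer vertices unpaired. *)
Lemma max_pairing_unpaired e f x y :
    symmetric e -> reflexive e -> max_pairing e f ->
  x \in unpaired f -> y \in unpaired f -> e x y -> x = y.
Proof.
move=> e_sym e_refl [fP f_min] xF yF exy; apply/eqP; apply: contraT => neq_xy.
have [fx fy] : f x = x /\ f y = y by split; apply/eqP; rewrite !inE in xF yF.
have /f_min := rematch_pairing e_sym e_refl fP fx neq_xy exy.
rewrite unpaired_rematch ?fy //; last by case: fP.
rewrite leqNgt => /negP[]; apply/proper_card/properP; split.
  by apply/subsetP=> z; rewrite !inE => /andP[/negPf-> /andP[]].
by exists x => //; rewrite !inE eqxx (negPf neq_xy) andbF.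
Qed.

(** [p] is traded for [f q], so the number of unpaired vertices does not grow. This is how further
    vertices are exposed as unpaired in some maximum pairing. *)
Lemma max_pairing_rematch e f p q :
    symmetric e -> reflexive e -> max_pairing e f ->
    p \in unpaired f -> q \notin unpaired f -> e p q ->
  max_pairing e (rematch f p q) /\
  unpaired (rematch f p q) = f q |: (unpaired f :\ p).
Proof.
move=> e_sym e_refl [fP f_min] pF qF epq.
have neq_pq : p != q by apply: contraNneq qF => <-.
have [fK ef] := fP.
have fp : f p = p by apply/eqP; rewrite inE in pF.
have unpE : unpaired (rematch f p q) = f q |: (unpaired f :\ p).
  rewrite unpaired_rematch //; apply/setDidPl.
  rewrite disjoint_sym disjoints1 !inE negb_or negb_and.
  by rewrite inE in qF; rewrite eq_sym qF orbT.
split=> //; split=> [|g gP]; first exact: rematch_pairing.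
rewrite unpE (leq_trans _ (f_min g gP)) // (cardsD1 p (unpaired f)) pF.
by rewrite cardsU1 leq_add2r leq_b1.
Qed.

(** * Cliques outside the set of universal vertices *)

Section Cliques.
Variable e : rel V.
Hypotheses (e_sym : symmetric e) (e_refl : reflexive e).
Let U := [set u | [forall z, e u z]].
(** Outside [U] this makes [e] an equivalence relation, whose classes are the cliques. *)
Hypothesis e_trans : forall a b c, b \notin U -> e a b -> e b c -> e a c.
Hypotheses (V_even : ~~ odd #|V|) (e_unpairable : ~~ has_pairing e).

Let eU u z : u \in U -> e u z.
Proof. by rewrite inE => /forallP. Qed.

(** Pairs use up an even number of vertices, so the defect is even; defect 0 would be a full
    pairing. *)
Lemma two_unpaired f : max_pairing e f -> 1 < #|unpaired f|.
Proof.
move=> [[fK ef] _].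
have even_unpaired : ~~ odd #|unpaired f|.
  have := V_even; rewrite -(cardsC (unpaired f)) oddD.
  suff /negPf->: ~~ odd #|~: unpaired f| by rewrite addbF.
  by apply: (involution_even fK) => x; rewrite !inE // (inj_eq (inv_inj fK)).
have unpaired_gt0 : 0 < #|unpaired f|.
  rewrite card_gt0; apply: contra e_unpairable => /eqP unp0.
  apply/has_pairingP; exists f; split=> // x.
  by have := in_set0 x; rewrite -unp0 inE => ->.
by case: #|_| even_unpaired unpaired_gt0 => [|[|]].
Qed.

Lemma other_unpaired f x : max_pairing e f -> exists2 y, y \in unpaired f & y != x.
Proof.
move=> /two_unpaired f_gt1; have : 0 < #|unpaired f :\ x|.
  by have := cardsD1 x (unpaired f); case: (x \in _) => E; rewrite E in f_gt1 * => //; exact: ltnW.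
by case/card_gt0P=> y; rewrite !inE => /andP[]; exists y; rewrite ?inE.
Qed.

(** A second unpaired vertex would be adjacent to [u], against maximality. *)
Lemma universal_paired f u : max_pairing e f -> u \in U -> u \notin unpaired f.
Proof.
move=> f_max uU; apply/negP => uF; have [y yF /eqP[]] := other_unpaired u f_max.
exact/esym/(max_pairing_unpaired e_sym e_refl f_max)/eU.
Qed.

(** Pairing [u] with an unpaired vertex leaves [f u] unpaired in another maximum pairing, which no
    universal vertex is. *)
Lemma universal_mate f u : max_pairing e f -> u \in U -> f u \notin U.
Proof.
move=> f_max uU; have [x xF _] := other_unpaired u f_max.
have uF := universal_paired f_max uU.
have exu : e x u by rewrite e_sym eU.
have [f'_max unpE] := max_pairing_rematch e_sym e_refl f_max xF uF exu.
by apply/negP=> /(universal_paired f'_max); rewrite unpE !inE eqxx.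
Qed.

(** Two unpaired vertices exist, so [u] can be paired with one other than [z]; then [z] and [f u]
    are both unpaired in a maximum pairing. *)
Lemma unpaired_nonadj_mate f z u :
  max_pairing e f -> z \in unpaired f -> u \in U -> ~~ e z (f u).
Proof.
move=> f_max zF uU; have [x xF neq_xz] := other_unpaired z f_max.
have uF := universal_paired f_max uU.
have exu : e x u by rewrite e_sym eU.
have [f'_max unpE] := max_pairing_rematch e_sym e_refl f_max xF uF exu.
have zF' : z \in unpaired (rematch f x u).
  by rewrite unpE in_setU in_setD1 zF eq_sym neq_xz orbT.
have fuF' : f u \in unpaired (rematch f x u) by rewrite unpE !inE eqxx.
apply/negP => /(max_pairing_unpaired e_sym e_refl f'_max zF' fuF') zE.
move: zF uF; rewrite zE !inE; case: f_max => -[fK _] _.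
by rewrite (inj_eq (inv_inj fK)) => ->.
Qed.

(** Pairing [u] with an unpaired vertex exposes [f u], while a [v] different from [u] keeps its
    mate; the previous lemma applies to the new pairing. *)
Lemma mates_nonadj f u v :
  max_pairing e f -> u \in U -> v \in U -> e (f u) (f v) -> u = v.
Proof.
move=> f_max uU vU; have [x xF _] := other_unpaired u f_max.
have uF := universal_paired f_max uU.
have exu : e x u by rewrite e_sym eU.
have [f'_max unpE] := max_pairing_rematch e_sym e_refl f_max xF uF exu.
have fuF : f u \in unpaired (rematch f x u) by rewrite unpE !inE eqxx.
have := unpaired_nonadj_mate f'_max fuF vU; rewrite /rematch.
have [|_] := eqVneq v x; first by move=> vE; have /negP[] := universal_paired f_max vU; rewrite vE.
have [-> //|_] := eqVneq v u.
have [vE|_] := eqVneq v (f u); last by move/negPf->.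
by have /negP[] := universal_mate f_max uU; rewrite -vE.
Qed.

(** [T] consists of the mates of [U] and the unpaired vertices. Its members lie in distinct cliques,
    and [f] pairs off the rest of each clique: a vertex there that is unpaired or has its mate in
    [U] is in [T], hence is [t]. *)
Lemma odd_cliques :
  exists T : {set V},
    [/\ #|U| < #|T|, [disjoint T & U], {in T &, forall x y, e x y -> x = y}
      & {in T, forall t, odd #|[set z | (z \notin U) && e t z]|}].
Proof.
have [f f_max] := max_pairing_exists e_refl.
have [[fK ef] _] := f_max.
have nonadj : {in f @: U :|: unpaired f &, forall x y, e x y -> x = y}.
  move=> x y /setUP[/imsetP[u uU ->] | xF] /setUP[/imsetP[v vU ->] | yF].
  - by move/(mates_nonadj f_max uU vU) ->.
  - by rewrite e_sym (negPf (unpaired_nonadj_mate f_max yF uU)).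
  - by rewrite (negPf (unpaired_nonadj_mate f_max xF vU)).
  exact: (max_pairing_unpaired e_sym e_refl f_max).
exists (f @: U :|: unpaired f); split=> //.
- have disj : [disjoint f @: U & unpaired f].
    apply/pred0P=> x /=; apply/negP=> /andP[/imsetP[u uU ->]]; rewrite inE fK => /eqP fu.
    by have /negP[] := universal_paired f_max uU; rewrite inE -fu.
  rewrite cardsU disjoint_setI0 // cards0 subn0 card_imset; last exact: inv_inj.
  by rewrite -addn1 leq_add2l ltnW ?two_unpaired.
- apply/pred0P=> x /=; apply/negP=> /andP[/setUP[/imsetP[u uU ->] | xF] xU].
    by have /negP[] := universal_mate f_max uU.
  by have /negP[] := universal_paired f_max xU.
move=> t tT.
have tU : t \notin U.
  case/setUP: tT => [/imsetP[u uU ->] | tF]; first exact: universal_mate.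
  by apply: contraL tF => /(universal_paired f_max).
have only_t z : e t z -> z \in f @: U :|: unpaired f -> z = t.
  by move=> etz zT; apply/esym/nonadj.
rewrite (cardsD1 t) inE tU e_refl /=.
apply: (involution_even fK) => z /setD1P[neq_zt]; rewrite inE => /andP[zU etz].
  rewrite in_setD1 in_set (e_trans zU etz (ef z)) andbT; apply/andP; split.
    apply: contra neq_zt => /eqP fzt; case/setUP: tT => [/imsetP[u uU tE] | ].
      by have zE := inv_inj fK (etrans fzt tE); rewrite zE uU in zU.
    by rewrite -fzt inE fK.
  apply: contra neq_zt => fzU; apply/eqP/only_t => //.
  by rewrite in_setU -(fK z) imset_f.
apply: contra neq_zt => fz; apply/eqP/only_t => //.
by rewrite in_setU [z \in unpaired f]inE fz orbT.
Qed.
End Cliques.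

(** * Edge-maximal graphs without a perfect matching *)

Section EdgeMaximal.
Variable E : {set V * V}.
Let e : rel V := fun x y => (x, y) \in E.
Hypotheses (e_sym : symmetric e) (e_refl : reflexive e).
Hypothesis e_unpairable : ~~ has_pairing e.
Hypothesis E_max : forall F : {set V * V},
  E \subset F -> symmetric (fun x y => (x, y) \in F) ->
  ~~ has_pairing (fun x y => (x, y) \in F) -> F = E.

(** By maximality, adding the edge creates a pairing, which must use it since [e] has none. *)
Lemma pairing_with_edge p q : ~~ e p q ->
  exists f, [/\ involutive f, forall x, f x != x, f p = q
              & forall x, x != p -> x != q -> e x (f x)].
Proof.
move=> not_epq; pose F := E :|: [set (p, q); (q, p)].
have F_sym : symmetric (fun x y => (x, y) \in F).
  move=> x y; rewrite !inE -![_ \in E]/(e _ _) e_sym !xpair_eqE.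
  by rewrite [(x == q) && _]andbC [(x == p) && _]andbC [X in _ || X]orbC.
have /has_pairingP[f [fK f_neq fF]] : has_pairing (fun x y => (x, y) \in F).
  apply: contraNT not_epq => /(E_max (subsetUl _ _) F_sym) FE.
  by rewrite /e -FE !inE eqxx orbT.
have [fp | neq_fp] := eqVneq (f p) q.
  exists f; split=> // x neq_xp neq_xq.
  have := fF x; rewrite !inE !xpair_eqE (negPf neq_xp) (negPf neq_xq) /=.
  by rewrite !orbF.
case/has_pairingP: e_unpairable; exists f; split=> // x.
have := fF x; rewrite !inE !xpair_eqE => /or3P[// | | ] /andP[/eqP-> /eqP fE].
  by rewrite fE eqxx in neq_fp.
by rewrite -fE fK eqxx in neq_fp.
Qed.

(** [b] has a nonneighbour [d]. If [a] and [c] were not adjacent, the pairings gained by adding [ac]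
    and by adding [bd] could be exchanged into one for [e]. *)
Lemma edge_maximal_trans a b c :
  b \notin [set u | [forall z, e u z]] -> e a b -> e b c -> e a c.
Proof.
rewrite inE negb_forall => /existsP[d not_ebd] eab ebc.
apply: contraNT e_unpairable => not_eac.
have [f [fK f_neq fa ef]] := pairing_with_edge not_eac.
have [g [gK g_neq gb eg]] := pairing_with_edge not_ebd.
apply: (exchange_pairing e_sym fK gK f_neq g_neq fa gb) => //.
  by apply: contraNneq not_eac => ->.
by apply: contraNneq not_eac => ->.
Qed.
End EdgeMaximal.

(** [P] consists of the cliques of an edge-maximal relation above [e]. For [e] itself they are
    unions of components off [U], perhaps not connected, but still odd, disjoint and separated. *)
Theorem tutte e : symmetric e -> ~~ odd #|V| -> ~~ has_pairing e ->
  exists (U : {set V}) (P : {set {set V}}),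
    [/\ #|U| < #|P|, trivIset P,
        forall K, K \in P -> odd #|K| /\ [disjoint K & U]
      & forall K x y, K \in P -> x \in K -> y \notin K -> y \notin U -> ~~ e x y].
Proof.
move=> e_sym V_even e_unpairable.
(* The diagonal gives the reflexivity that partial pairings rely on; it creates no pairing, since a
   pairing has no fixed point. *)
pose E0 := [set xy | (xy.1 == xy.2) || e xy.1 xy.2].
pose good (E : {set V * V}) :=
  [&& E0 \subset E, [forall x, forall y, ((x, y) \in E) == ((y, x) \in E)]
    & ~~ has_pairing (fun x y => (x, y) \in E)].
have good0 : good E0.
  apply/and3P; split=> //.
    by apply/forallP=> x; apply/forallP=> y; rewrite !inE /= e_sym [x == y]eq_sym.
  apply: contra e_unpairable => /has_pairingP[f [fK f_neq fE]].
  apply/has_pairingP; exists f; split=> // x.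
  by have := fE x; rewrite inE /= eq_sym (negPf (f_neq x)).
have [E /maxsetP[/and3P[E0E /forallP E_sym E_unpairable] E_max] _] := maxset_exists good0.
pose e' x y := (x, y) \in E.
have e'_sym : symmetric e' by move=> x y; have /forallP/(_ y)/eqP := E_sym x.
have e'_refl : reflexive e' by move=> x; apply: (subsetP E0E); rewrite inE eqxx.
have ee' x y : e x y -> e' x y.
  by move=> exy; apply: (subsetP E0E); rewrite inE exy orbT.
have e'_trans a b c : b \notin [set u | [forall z, e' u z]] -> e' a b -> e' b c -> e' a c.
  apply: edge_maximal_trans => // F EF F_sym F_unpairable; apply: E_max => //.
  rewrite /good F_unpairable (subset_trans E0E EF) andbT.
  by apply/forallP=> x; apply/forallP=> y; rewrite F_sym.
have [T [lt_UT TU T_nonadj odd_K]] := odd_cliques e'_sym e'_refl e'_trans V_even E_unpairable.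
set U := [set u | _] in lt_UT TU odd_K e'_trans; clearbody U.
pose K t := [set z | (z \notin U) && e' t z].
have TnU t : t \in T -> t \notin U by move=> tT; rewrite (disjointFr TU).
have tK t : t \in T -> t \in K t by move=> tT; rewrite inE TnU ?e'_refl.
have K_meet s t z : s \in T -> t \in T -> z \in K s -> z \in K t -> s = t.
  move=> sT tT; rewrite !inE => /andP[zU esz] /andP[_ etz].
  by apply: T_nonadj => //; apply: e'_trans zU esz _; rewrite e'_sym.
exists U, (K @: T); split.
- rewrite card_in_imset // => s t sT tT KE; apply: (K_meet s t s) => //; first exact: tK.
  by rewrite -KE tK.
- apply/trivIsetP=> _ _ /imsetP[s sT ->] /imsetP[t tT ->]; apply: contraNT.
  by case/pred0Pn=> z /andP[zs zt]; rewrite (K_meet s t z).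
- move=> _ /imsetP[t tT ->]; split; first exact: odd_K.
  by apply/pred0P=> z /=; rewrite inE; case: (z \in U); rewrite ?andbF.
move=> _ x y /imsetP[t tT ->]; rewrite !inE => /andP[xU etx] yK yU.
by apply: contra yK => /ee' exy; rewrite yU (e'_trans _ _ _ xU etx exy).
Qed.

End Tutte.

(** * Cubic bridgeless graphs *)

Section CubicGraph.
Variable G : graph.
Implicit Types (v x y : vertex G) (d : edge G) (A B C M N : {set edge G}) (K U : {set vertex G}).

Lemma sum_incidence M K :
  \sum_(v in K) #|[set d in M | v \in ends d]| = \sum_(d in M) #|ends d :&: K|.
Proof.
under eq_bigr do rewrite -sum1dep_card big_mkcondr.
rewrite exchange_big; apply: eq_bigr => d _ /=.
by rewrite -big_mkcondr sum1dep_card; apply: eq_card => v; rewrite !inE andbC.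
Qed.

Lemma card_perfect_matching M : perfect_matching M -> #|vertex G| = 2 * #|M|.
Proof.
move=> /forallP M_perfect; have := sum_incidence M setT.
under eq_bigr => v _ do rewrite (eqP (M_perfect v)).
under [RHS]eq_bigr => d _ do rewrite setIT ends_card.
by rewrite sum1_card cardsT sum_nat_const mulnC.
Qed.

Definition boundary K : {set edge G} := [set d | #|ends d :&: K| == 1].

Definition adjacent : rel (vertex G) := fun x y => [exists d, ends d == [set x; y]].

Lemma adjacent_sym : symmetric adjacent.
Proof. by move=> x y; apply: eq_existsb => d; rewrite setUC. Qed.

Lemma perfect_matching_of_pairing :
  has_pairing adjacent -> exists M, perfect_matching M.
Proof.
case/has_pairingP=> f [fK f_neq f_adj].
(* The choice by [pick] keeps one edge from each class of parallel edges. *)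
exists [set d | [exists x, ends d == [set x; f x]] &&
                ([pick d' | ends d' == ends d] == Some d)].
apply/forallP=> v; have /existsP[d0 d0E] := f_adj v.
have [d dE d_pick] : exists2 d, ends d == [set v; f v]
    & [pick d' | ends d' == [set v; f v]] = Some d.
  by case: pickP => [d dE|/(_ d0)]; [exists d | rewrite d0E].
apply/cards1P; exists d; apply/setP=> d'; rewrite !inE.
apply/idP/eqP => [/andP[/andP[/existsP[x /eqP d'E] /eqP d'_pick] vd'] | ->].
  have d'E' : ends d' = [set v; f v].
    move: vd'; rewrite d'E !inE => /orP[]/eqP-> //.
    by rewrite fK setUC.
  by move: d'_pick; rewrite d'E' d_pick => -[].
rewrite (eqP dE) d_pick !inE !eqxx !andbT; apply/existsP; exists v.
by rewrite eqxx.
Qed.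

Lemma boundary_ends K d : d \in boundary K ->
  exists x y, [/\ ends d = [set x; y], x \in K & y \notin K].
Proof.
rewrite inE => /cards1P[x xE].
have /setIP[xd xK] : x \in ends d :&: K by rewrite xE inE.
have [y /setD1P[neq_yx yd]] : exists y, y \in ends d :\ x.
  by apply/card_gt0P; have := ends_card d; rewrite (cardsD1 x) xd add1n => -[->].
exists x, y; split=> //.
  apply/esym/eqP; rewrite eqEcard ends_card cards2 eq_sym neq_yx andbT.
  by rewrite subUset !sub1set xd.
by apply: contra neq_yx => yK; have := in_set1 y x; rewrite -xE inE yd yK => <-.
Qed.

(** * Edge boundaries in cubic bridgeless graphs *)

Hypothesis G_cubic : cubic G.

Lemma sum_degree K : \sum_d #|ends d :&: K| = 3 * #|K|.
Proof.
have -> : \sum_d #|ends d :&: K| = \sum_(v in K) #|[set d in setT | v \in ends d]|.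
  by rewrite sum_incidence; apply: eq_bigl => d; rewrite inE.
rewrite mulnC -sum_nat_const; apply: eq_bigr => v _; rewrite -(G_cubic v) /degree.
by apply: eq_card => d; rewrite !inE.
Qed.

Lemma card_edge_cubic : 2 * #|edge G| = 3 * #|vertex G|.
Proof.
rewrite -(cardsT (vertex G)) -sum_degree; under eq_bigr do rewrite setIT ends_card.
by rewrite sum_nat_const mulnC.
Qed.

(** The degree sum [3 * #|K|] counts boundary edges once and edges inside [K] twice. *)
Lemma odd_boundary K : odd #|boundary K| = odd #|K|.
Proof.
have <- : odd (3 * #|K|) = odd #|K| by rewrite oddM.
rewrite -sum_degree (bigID (mem (boundary K))) /= oddD.
rewrite [X in _ (+) odd X](_ : _ = 2 * \sum_(d | d \notin boundary K) (#|ends d :&: K| == 2)).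
  rewrite oddM addbF (eq_bigr (fun=> 1)) => [|d]; last by rewrite inE => /eqP.
  by rewrite sum1_card.
rewrite big_distrr; apply: eq_bigr => d; rewrite inE.
have : #|ends d :&: K| <= 2 by rewrite -(ends_card d) subset_leq_card ?subsetIl.
by case: #|_| => [|[|[|]]].
Qed.

Hypothesis G_bridgeless : bridgeless G.

(** The ends of a lone boundary edge stay connected after its deletion, by bridgelessness, yet no
    remaining edge leaves [K]. *)
Lemma boundary_neq1 K : #|boundary K| != 1.
Proof.
apply/negP=> /cards1P[d dK].
have [x [y [dE xK yK]]] : exists x y, [/\ ends d = [set x; y], x \in K & y \notin K].
  by apply: boundary_ends; rewrite dK inE.
have xC : x \in component x by rewrite inE connect0.
have yC : y \in component x.
  rewrite inE connect1 // /adj_in !inE /=.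
  by apply/existsP; exists d; rewrite inE dE eqxx.
have := G_bridgeless (F := [set d]) _ xC yC; rewrite cards1 => /(_ isT).
have closedK : closed (adj_in (component x) [set d]) (mem K).
  move=> a b /and3P[_ _ /existsP[d' /andP[d'd /eqP d'E]]] /=.
  rewrite -dK inE d'E in d'd.
  apply: contraNeq d'd; case aK: (a \in K); case bK: (b \in K) => // _.
    apply/cards1P; exists a; apply/setP=> z; rewrite !inE.
    by case: eqP => [->|_]; rewrite ?aK //=; case: eqP => // ->; rewrite bK.
  apply/cards1P; exists b; apply/setP=> z; rewrite !inE orbC.
  by case: eqP => [->|_]; rewrite ?bK //=; case: eqP => // ->; rewrite aK.
by move/(closed_connect closedK); rewrite /= xK (negPf yK).
Qed.

(** * Petersen's theorem *)

Theorem petersen : exists M, perfect_matching M.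
Proof.
apply: perfect_matching_of_pairing; apply: contraT => unpairable.
have V_even : ~~ odd #|vertex G|.
  by have := congr1 odd card_edge_cubic; rewrite !oddM /= => <-.
have [U [P [lt_UP /trivIsetP P_triv P_odd P_sep]]] :=
  tutte adjacent_sym V_even unpairable.
have boundary_ge3 K : K \in P -> 3 <= #|boundary K|.
  case/P_odd=> K_odd _; have := odd_boundary K; have := boundary_neq1 K.
  by rewrite K_odd; case: #|_| => [|[|[|]]].
have boundary_to_U K d : K \in P -> d \in boundary K ->
    exists x y, [/\ ends d = [set x; y], x \in K & y \in U].
  move=> KP /boundary_ends[x [y [dE xK yK]]]; exists x, y; split=> //.
  apply: contraT => yU; have /negP[] := P_sep K x y KP xK yK yU.
  by apply/existsP; exists d; rewrite dE.
have : 3 * #|P| <= 3 * #|U|; last by rewrite leq_pmul2l // leqNgt lt_UP.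
rewrite -sum_degree mulnC -sum_nat_const.
(* Both sides are compared edge by edge: the members of [P] having [d] on their boundary are at most
   as many as the ends of [d] in [U]. *)
apply: (@leq_trans (\sum_(K in P) \sum_d (d \in boundary K))).
  by apply: leq_sum => K /boundary_ge3; rewrite -sum1_card big_mkcond.
rewrite exchange_big leq_sum //= => d _.
rewrite -big_mkcondr sum1dep_card.
set Pd := [set K | _].
have [-> | [K]] := set_0Vmem Pd; first by rewrite cards0.
rewrite inE => /andP[KP /(boundary_to_U K d KP)[x [y [dE xK yU]]]].
apply: (@leq_trans 1); last first.
  by rewrite card_gt0; apply/set0Pn; exists y; rewrite dE !inE eqxx orbT.
(* One end of [d] is in [U], which every member of [P] avoids; the other end lies in only one
   member. *)
suff only_K L : L \in Pd -> L = K.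
  by apply/card_le1_eqP => K1 K2 /only_K-> /only_K->.
rewrite inE => /andP[LP /(boundary_to_U L d LP)[z [w [dE' zL _]]]].
have : z \in [set x; y] by rewrite -dE dE' !inE eqxx.
case/set2P => zE; last first.
  by have [_ /disjointFr/(_ zL)] := P_odd L LP; rewrite zE yU.
apply/eqP; apply: contraT => /(P_triv _ _ LP KP)/disjointFr/(_ zL).
by rewrite zE xK.
Qed.

(** * Unions of two and three perfect matchings *)

Lemma max_union_perfect t : exists M : {ffun 'I_t -> {set edge G}},
  (forall i, perfect_matching (M i)) /\ max_union G t = #|\bigcup_(i < t) M i|.
Proof.
have [M0 M0P] := petersen.
pose good (M : {ffun 'I_t -> {set edge G}}) := [forall i, perfect_matching (M i)].
(* Petersen's theorem makes the family nonempty, so the maximum is attained and is not the default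
   0. *)
have good_gt0 : 0 < #|good|.
  by apply/card_gt0P; exists [ffun=> M0]; apply/forallP=> i; rewrite ffunE.
have [M /forallP MP maxM] :=
  eq_bigmax_cond (fun M : {ffun 'I_t -> {set edge G}} => #|\bigcup_(i < t) M i|) good_gt0.
by exists M.
Qed.

Lemma perfect_matching_cup M N : perfect_matching M -> perfect_matching N ->
  #|M :|: N| <= max_union G 2.
Proof.
move=> MP NP; pose F := [ffun i : 'I_2 => if i == ord0 then M else N].
have FP : [forall i, perfect_matching (F i)].
  by apply/forallP=> i; rewrite ffunE; case: ifP.
apply: leq_trans (leq_bigmax_cond F FP).
by rewrite !big_ord_recl big_ord0 !ffunE /= setU0.
Qed.

Lemma perfect_matching_cup3 A B C :
    perfect_matching A -> perfect_matching B -> perfect_matching C ->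
  3 * #|A :|: (B :|: C)| + #|edge G| <= 6 * max_union G 2.
Proof.
move=> AP BP CP.
have cardA : #|edge G| = 3 * #|A|.
  apply/eqP; rewrite -(eqn_pmul2l (ltn0Sn 1)) card_edge_cubic.
  by rewrite (card_perfect_matching AP) mulnCA.
(* The two sets on the right have union [A :|: (B :|: C)] and an intersection containing [A]. *)
have submod : #|A :|: (B :|: C)| + #|A| <= #|A :|: B| + #|A :|: C|.
  rewrite -(cardsUI (A :|: B)) leq_add ?subset_leq_card //.
    by rewrite setUACA setUid.
  by rewrite -setUIr subsetUl.
rewrite cardA -mulnDr -[6]/(3 * 2) -mulnA leq_pmul2l //.
by rewrite (leq_trans submod) // mul2n -addnn leq_add ?perfect_matching_cup.
Qed.

(** The final bound multiplied by [6 * #|edge G|], which keeps it in the natural numbers. *)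
Lemma max_union3_le : 3 * max_union G 3 + #|edge G| <= 6 * max_union G 2.
Proof.
have [M [MP ->]] := max_union_perfect 3.
rewrite !big_ord_recl big_ord0 setU0.
exact: perfect_matching_cup3 (MP _) (MP _) (MP _).
Qed.

End CubicGraph.

Local Open Scope ring_scope.

Theorem theorem10 (G : graph) (G_nonempty : (0 < #|vertex G|)%N)
    (G_cubic : cubic G) (G_bridgeless : bridgeless G) :
  m G 2 >= 1 / 2 * m G 3 + 1 / 6.
Proof.
(* Without edges, division by zero would make both ratios 0 and the bound false. *)
have E_gt0 : (0 < #|edge G|)%N.
  by rewrite -(ltn_pmul2l (ltn0Sn 1)) card_edge_cubic // muln0 muln_gt0.
have E_gt0R : (0 < #|edge G|%:R :> rat)%R by rewrite ltr0n.
have := max_union3_le G_cubic G_bridgeless.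
rewrite -(ler_nat rat) natrD !natrM /m => ineq.
rewrite ler_pdivlMr // mulrDl mulrA divfK ?gt_eqF //.
lra.
Qed.
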